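(* Let $p\in\mathbb{N}\setminus\{0\}$. If $S$ is an $\mathbb{N}^p$-semigroup with $S\neq \{0\}$ and $S\neq \mathbb{N}^p$, then $\mathrm{e}(S)\geq 2p$.
   Context: $\mathbb{N}$ is the set of nonnegative integers. An affine semigroup is a finitely generated submonoid of $(\mathbb{N}^p,+)$; it has a unique minimal generating set (as a monoid), whose cardinality is its embedding dimension $\mathrm{e}(S)$. An $\mathbb{N}^p$-semigroup is an affine semigroup $S\subset\mathbb{N}^p$ such that $\mathbb{N}^p\setminus S$ is finite. *)

(* Defs.v *)
From mathcomp Require Import all_boot all_order all_algebra finmap.
From mathcomp Require Import boolp classical_sets functions cardinality.

Set Implicit Arguments.
Unset Strict Implicit.
Unset Printing Implicit Defensive.

Import GRing.Theory.

Local Open Scope classical_set_scope.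

Definition submonoid (p : nat) (S : set 'rV[nat]_p) : Prop :=
  GRing.nmod_closed [in S].

Definition gen_submonoid (p : nat) (A : set 'rV[nat]_p) : set 'rV[nat]_p :=
  smallest (@submonoid p) A.

Definition generating_set (p : nat) (S A : set 'rV[nat]_p) : Prop :=
  gen_submonoid A = S.

Definition affine_semigroup (p : nat) (S : set 'rV[nat]_p) : Prop :=
  submonoid S /\ exists A, finite_set A /\ generating_set S A.

Definition minimal_generating_set (p : nat) (S A : set 'rV[nat]_p) : Prop :=
  generating_set S A /\
  forall B, B `<=` A -> generating_set S B -> B = A.

(* Every submonoid of N^p has exactly one minimal generating set, and it is
   finite when the submonoid is finitely generated ([minimal_generating_setP] and
   [affine_minimal_generating_set] below), so
   for an affine semigroup neither the default value of [xget] nor that of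
   [fset_set] on infinite sets is ever used. *)
Definition embdim (p : nat) (S : set 'rV[nat]_p) : nat :=
  #|` fset_set (xget set0 (minimal_generating_set S)) |.

Definition Np_semigroup (p : nat) (S : set 'rV[nat]_p) : Prop :=
  affine_semigroup S /\ finite_set (~` S).

Lemma gen_submonoid_closed p (A : set 'rV[nat]_p) : submonoid (gen_submonoid A).
Proof.
split; first by rewrite inE => M [[/set_mem M0 _] _].
move=> u v /set_mem uA /set_mem vA; apply: mem_set => M /= [Mc AM].
by apply/set_mem/(proj2 Mc); apply/mem_set; [apply: uA | apply: vA].
Qed.

Definition atoms p (S : set 'rV[nat]_p) : set 'rV[nat]_p :=
  [set x | [/\ S x, x <> 0%R &
     forall u v, S u -> S v -> x = (u + v)%R -> u = 0%R \/ v = 0%R]].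

Lemma atoms_sub p (S A : set 'rV[nat]_p) :
  generating_set S A -> atoms S `<=` A.
Proof.
move=> SA x [Sx x0 xirr]; apply: contrapT => nAx.
have AS : A `<=` S by rewrite -SA; exact: sub_gen_smallest.
have Sc : submonoid S by rewrite -SA; exact: gen_submonoid_closed.
have /(_ x Sx) [_] // : S `<=` [set y | S y /\ y <> x].
rewrite -{1}SA; apply: smallest_sub; last first.
  by move=> y Ay; split; [exact: AS | move=> yx; apply: nAx; rewrite -yx].
split; first by apply: mem_set; split; [exact/set_mem/(proj1 Sc) | move/esym].
move=> u v /set_mem [Su ux] /set_mem [Sv vx]; apply: mem_set; split.
  by apply/set_mem/(proj2 Sc); apply: mem_set.
move=> uvx; have [u0|v0] := xirr u v Su Sv (esym uvx).
- by apply: vx; rewrite -uvx u0 add0r.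
- by apply: ux; rewrite -uvx v0 addr0.
Qed.

Lemma atoms_generate p (S : set 'rV[nat]_p) :
  submonoid S -> generating_set S (atoms S).
Proof.
move=> Sc; apply/seteqP; split; first by apply: smallest_sub => // x [].
pose w (x : 'rV[nat]_p) := (\sum_i x ord0 i)%N.
have wD u v : w (u + v)%R = (w u + w v)%N.
  by rewrite /w -big_split; apply: eq_bigr => i _; rewrite mxE.
have w0 u : w u = 0%N -> u = 0%R.
  move=> /eqP; rewrite sum_nat_eq0 => /forallP u0; apply/rowP => i.
  by rewrite mxE; apply/eqP; exact: (implyP (u0 i)).
suff H m x : w x < m -> S x -> gen_submonoid (atoms S) x.
  by move=> x; apply: (H (w x).+1).
elim: m x => // m IH x xm Sx.
have [gen0 genD] := gen_submonoid_closed (atoms S).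
have [->|x0] := eqVneq x 0%R; first exact/set_mem.
have [xa|nxa] := pselect (atoms S x); first exact: sub_gen_smallest.
have [u [v [Su Sv xuv u0 v0]]] : exists u v : 'rV[nat]_p,
    [/\ S u, S v, x = (u + v)%R, u <> 0%R & v <> 0%R].
  apply: contrapT => nuv; apply: nxa; split=> //; first exact/eqP.
  move=> u v Su Sv xuv; apply: contrapT => /not_orP [u0 v0].
  by apply: nuv; exists u, v.
have wu : 0 < w u by rewrite lt0n; apply/eqP => /w0.
have wv : 0 < w v by rewrite lt0n; apply/eqP => /w0.
move: xm; rewrite xuv wD ltnS => xm.
apply/set_mem/genD; apply: mem_set; apply: IH => //.
- by apply: leq_trans xm; rewrite -addn1 leq_add2l.
- by apply: leq_trans xm; rewrite -add1n leq_add2r.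
Qed.

Lemma minimal_generating_setP p (S A : set 'rV[nat]_p) :
  submonoid S -> minimal_generating_set S A <-> A = atoms S.
Proof.
move=> Sc; have atS := atoms_generate Sc; split.
  by move=> [SA Amin]; rewrite (Amin _ (atoms_sub SA) atS).
move=> ->; split=> // B BA SB; apply/seteqP; split=> //.
exact: atoms_sub.
Qed.

Lemma affine_minimal_generating_set p (S : set 'rV[nat]_p) :
  affine_semigroup S ->
  exists A, [/\ finite_set A, minimal_generating_set S A &
    forall B, minimal_generating_set S B -> B = A].
Proof.
move=> [Sc [G [Gfin SG]]]; exists (atoms S); split.
- exact: sub_finite_set (atoms_sub SG) Gfin.
- exact/minimal_generating_setP.
- by move=> B /minimal_generating_setP; apply.
Qed.

(* Main.v *)
(* A face of N^p keeps atoms: an atom of the part of S on a coordinate axis is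
   an atom of S.  Let m_i e_i be the first nonzero element of S on axis i; it
   is an atom.  If m_i > 1, the first element of S on axis i whose coefficient
   is not a multiple of m_i is a second atom.  As S <> N^p, some e_k is not in
   S; if m_i = 1, the first element of S of the form e_k + n e_i is an atom
   off the axes.  These 2p atoms are pairwise distinct. *)
Require Import Defs.
From mathcomp Require Import all_boot all_order all_algebra finmap.
From mathcomp Require Import boolp classical_sets functions cardinality.

Local Open Scope classical_set_scope.

Import GRing.Theory.

Definition axis (p : nat) (i : 'I_p) (n : nat) : 'rV[nat]_p :=
  (\row_j (if j == i then n else 0%N))%R.

Arguments axis {p} i n.

Lemma axis0 p (i : 'I_p) : axis i 0 = 0%R.
Proof. by apply/rowP => j; rewrite !mxE; case: ifP. Qed.

Lemma axisD p (i : 'I_p) m n : axis i (m + n) = (axis i m + axis i n)%R.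
Proof. by apply/rowP => j; rewrite !mxE; case: ifP. Qed.

Lemma axis_eq0 p (i : 'I_p) n : axis i n = 0%R -> n = 0%N.
Proof. by move=> /rowP/(_ i); rewrite !mxE eqxx. Qed.

Lemma row_sum_axis p (x : 'rV[nat]_p) : x = (\sum_i axis i (x ord0 i))%R.
Proof.
apply/rowP => j; rewrite summxE (bigD1 j) //= big1 ?addr0 ?mxE ?eqxx //.
by move=> i ij; rewrite mxE eq_sym (negbTE ij).
Qed.

(** A sum of natural numbers vanishes only if both terms do, so the axis is a face of N^p. *)
Lemma axis_summand p (i : 'I_p) n (u v : 'rV[nat]_p) :
  axis i n = (u + v)%R -> u = axis i (u ord0 i).
Proof.
move=> /rowP uv; apply/rowP => j; rewrite mxE; case: eqP => [->//|/eqP ji].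
move: (uv j); rewrite !mxE (negbTE ji) => /esym/eqP.
by rewrite addn_eq0 => /andP[/eqP].
Qed.

Lemma finite_complement_bound p (S : set 'rV[nat]_p) :
  finite_set (~` S) ->
  exists N : nat, forall (x : 'rV[nat]_p) i, (N <= x ord0 i)%N -> S x.
Proof.
(* No entry of a gap exceeds the total of all entries of all gaps. *)
move=> /finite_seqP[s Ss]; exists (\sum_(y <- s) \sum_j y ord0 j).+1.
move=> x i; apply: contraPP => nSx; apply/negP; rewrite -ltnNge ltnS.
have xs : x \in s by have : (~` S) x by []; rewrite Ss.
rewrite (big_rem x) //= (bigD1 i) //= -addnA.
exact: leq_addr.
Qed.

Lemma first_natP (P : nat -> Prop) :
  (exists n, P n) -> exists2 n, P n & forall m, P m -> (n <= m)%N.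
Proof.
move=> [n Pn]; have exP : exists n, `[< P n >] by exists n; apply/asboolP.
by case: (ex_minnP exP) => m /asboolP Pm le_m; exists m => // k /asboolP/le_m.
Qed.

Section Atoms.
Variables (p : nat) (S : set 'rV[nat]_p).
Hypotheses (S0 : S 0%R) (SD : forall u v, S u -> S v -> S (u + v)%R).
Variable N : nat.
Hypothesis SN : forall (x : 'rV[nat]_p) i, (N <= x ord0 i)%N -> S x.

Lemma mem_axisM i m n : S (axis i m) -> S (axis i (n * m)).
Proof.
move=> Sm; elim: n => [|n IH]; first by rewrite mul0n axis0.
by rewrite mulSn axisD; exact: SD.
Qed.

(** The unit vectors generate N^p as a monoid. *)
Lemma exists_unit_notin : S <> setT -> exists k, ~ S (axis k 1).
Proof.
apply: contra_notP => /forallNP H; rewrite -subTset => x _.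
rewrite (row_sum_axis p x).
apply: big_ind => // i _; rewrite -[X in axis _ X]muln1; apply: mem_axisM.
exact: contrapT.
Qed.

(** Summands of an axis vector stay on that axis, so irreducibility need only be tested on
    coefficients. *)
Lemma atom_axis i n : (0 < n)%N -> S (axis i n) ->
  (forall a b, S (axis i a) -> S (axis i b) -> n = (a + b)%N ->
     a = 0%N \/ b = 0%N) ->
  atoms S (axis i n).
Proof.
move=> n0 Sn irr; split=> // [/axis_eq0 nE|u v Su Sv uv].
  by rewrite nE in n0.
have ua := axis_summand p i n u v uv.
have va : v = axis i (v ord0 i) by apply: (axis_summand p i n v u); rewrite addrC.
have nE : n = (u ord0 i + v ord0 i)%N.
  by move/rowP: uv => /(_ i); rewrite !mxE eqxx.
have [||u0|v0] := irr _ _ _ _ nE; rewrite -?ua -?va //.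
- by left; rewrite ua u0 axis0.
- by right; rewrite va v0 axis0.
Qed.

Lemma first_axis_atom i : exists m,
  [/\ (0 < m)%N, S (axis i m) & atoms S (axis i m)].
Proof.
have [|m [m0 Sm] mmin] :=
    @first_natP (fun n => (0 < n)%N /\ S (axis i n)).
  by exists N.+1; split=> //; apply: (SN _ i); rewrite mxE eqxx.
exists m; split=> //; apply: atom_axis => // a b Sa Sb mE.
have [->|a0] := posnP a; [by left|right].
have := mmin _ (conj a0 Sa); rewrite mE -{2}[a]addn0 leq_add2l leqn0.
by move/eqP.
Qed.

Lemma second_axis_atom i m : (1 < m)%N ->
  exists2 n, ~~ (m %| n)%N & atoms S (axis i n).
Proof.
move=> m1.
have [|n [mn Sn] nmin] :=
    @first_natP (fun n => ~~ (m %| n)%N /\ S (axis i n)).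
  (* This number is 1 modulo [m], and at least [N]. *)
  exists (N * m).+1; split.
    by rewrite -addn1 dvdn_addr ?dvdn_mull // dvdn1 gtn_eqF.
  apply: (SN _ i); rewrite mxE eqxx leqW // leq_pmulr //.
  exact: ltnW.
exists n => //; apply: atom_axis => // [|a b Sa Sb nE].
  by rewrite lt0n; apply: contra mn => /eqP ->.
(* As [m] does not divide [a + b], it fails to divide [a] or [b]; by minimality that summand is at
   least [n], so the other is 0. *)
have [ma|ma] := boolP (m %| a)%N.
- left; have := nmin b; rewrite nE dvdn_addr // in mn *.
  by move=> /(_ (conj mn Sb)); rewrite -{2}[b]add0n leq_add2r leqn0 => /eqP.
- right; have := nmin a (conj ma Sa).
  by rewrite nE -{2}[a]addn0 leq_add2l leqn0 => /eqP.
Qed.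

(** The [k]-entry is 1, so one of two summands has [k]-entry 0. The other is then again e_k plus a
    multiple of e_i, and minimality of [n] leaves nothing for the first. *)
Lemma mixed_atom k i : ~ S (axis k 1) -> k != i ->
  exists2 n, (0 < n)%N & atoms S (axis k 1 + axis i n)%R.
Proof.
move=> Sk ki.
have [|n Sn nmin] := @first_natP (fun n => S (axis k 1 + axis i n)%R).
  by exists N; apply: (SN _ i); rewrite !mxE eqxx; exact: leq_addl.
have n0 : (0 < n)%N.
  by rewrite lt0n; apply/eqP => nE; apply: Sk; rewrite nE axis0 addr0 in Sn.
exists n => //.
have summand0 (u v : 'rV[nat]_p) : S v ->
    (axis k 1 + axis i n = u + v)%R -> u ord0 k = 0%N -> u = 0%R.
  move=> Sv /rowP uv uk.
  have vE : v = (axis k 1 + axis i (v ord0 i))%R.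
    apply/rowP => j; move: (uv j); rewrite !mxE.
    have [->|jk] := eqVneq j k.
      by rewrite (negbTE ki) uk [RHS]add0r => <-.
    have [->//|ji] := eqVneq j i.
    by move=> /esym/eqP; rewrite addn_eq0 => /andP[_ /eqP].
  have nv : (n <= v ord0 i)%N by apply: nmin; rewrite -vE.
  apply/rowP => j; move: (uv j); rewrite !mxE.
  have [->//|jk] := eqVneq j k.
  have [->|ji] := eqVneq j i; last first.
    by move=> /esym/eqP; rewrite addn_eq0 => /andP[/eqP].
  rewrite [LHS]add0n => nE; move: nv; rewrite nE.
  by rewrite -{2}[v ord0 i]add0n leq_add2r leqn0 => /eqP.
split=> // [/rowP/(_ k)|u v Su Sv uv]; first by rewrite !mxE eqxx.
have /rowP/(_ k) := uv; rewrite !mxE eqxx (negbTE ki).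
case uk : (u ord0 k) => [|a]; first by left; exact: (summand0 u v).
case vk : (v ord0 k) => [|b]; last by rewrite [RHS]addnS.
by right; apply: (summand0 v u) => //; rewrite uv addrC.
Qed.

(** The support condition is what later separates atoms chosen for different [i], with [k] fixed. *)
Lemma two_atoms k i : ~ S (axis k 1) ->
  exists f : bool -> 'rV[nat]_p, [/\ f true <> f false &
    forall b, [/\ atoms S (f b), f b ord0 i <> 0%N &
      forall j, j != i -> j != k -> f b ord0 j = 0%N]].
Proof.
move=> Sk; have [m [m0 Sm am]] := first_axis_atom i.
have axisP n : (0 < n)%N -> axis i n ord0 i <> 0%N /\
    forall j, j != i -> j != k -> axis i n ord0 j = 0%N.
  by case: n => // n _; split=> [|j ji _]; rewrite mxE ?eqxx // (negbTE ji).
have [xm0 xm] := axisP m m0.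
have [m1|] := ltnP 1 m.
- have [n mn an] := second_axis_atom i m m1.
  have n0 : (0 < n)%N by rewrite lt0n; apply: contra mn => /eqP ->.
  have [xn0 xn] := axisP n n0.
  exists (fun b : bool => if b then axis i n else axis i m); split.
    move=> /rowP/(_ i); rewrite !mxE eqxx => nE.
    by move: mn; rewrite nE dvdnn.
  by case.
(* Now [m] is 1, so e_i lies in [S], which forces [k != i]. *)
- rewrite leq_eqVlt ltnNge m0 orbF => /eqP mE; rewrite mE in Sm am xm0 xm.
  have ki : k != i by apply/eqP => ki; apply: Sk; rewrite ki.
  have [n n0 an] := mixed_atom k i Sk ki.
  exists (fun b : bool =>
    if b then (axis k 1 + axis i n)%R else axis i 1); split.
    by move=> /rowP/(_ k); rewrite !mxE eqxx (negbTE ki).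
  case=> //; split=> //.
    by rewrite !mxE eqxx eq_sym (negbTE ki); case: (n) n0.
  by move=> j ji jk; rewrite !mxE (negbTE ji) (negbTE jk).
Qed.

End Atoms.

Lemma embdim_atoms p (S : set 'rV[nat]_p) : submonoid S ->
  embdim S = #|` fset_set (atoms S)|.
Proof.
move=> Sc; rewrite /embdim; case: xgetP => [A _|/(_ (atoms S))].
  by move=> /(minimal_generating_setP _ Sc) ->.
by case; exact/(minimal_generating_setP _ Sc).
Qed.

Theorem theorem7 (p : nat) (hp : p <> 0%N) (S : set 'rV[nat]_p)
    (hS : Np_semigroup S) (hS0 : S <> [set 0%R]) (hST : S <> setT) :
  (2 * p <= embdim S)%N.
Proof.
have [Saff /finite_complement_bound[N SN]] := hS.
have [Sc [G [Gfin SG]]] := Saff.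
have S0 : S 0%R by exact/set_mem/(proj1 Sc).
have SD u v : S u -> S v -> S (u + v)%R.
  by move=> Su Sv; apply/set_mem/(proj2 Sc); exact: mem_set.
have [k Sk] := exists_unit_notin p S S0 SD hST.
have /choice[f fP] := fun i => two_atoms p S N SN k i Sk.
have f_inj : injective (fun x : 'I_p * bool => f x.1 x.2).
  move=> [i b] [j c] /= fE; have [fij fi] := fP i; have [_ fj] := fP j.
  have [ij|ij] := eqVneq i j.
    rewrite -ij in fE *; congr (_, _).
    by case: b c fE => [] [] // fE; case: fij.
  (* The common value has nonzero entries at [i] and [j]. Its support lies in {j, k}, so [i = k]; it
     also lies in {i, k}, so [j = k], a contradiction. *)
  have [_ ib0 ib] := fi b; have [_ jc0 jc] := fj c.
  have ik : i = k by apply/eqP; apply: contra_notT ib0 => ik; rewrite fE jc.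
  have jk : j = k.
    by apply/eqP; apply: contra_notT jc0 => jk; rewrite -fE ib // eq_sym.
  by rewrite ik jk eqxx in ij.
(* Finiteness ensures that [fset_set] has exactly the atoms as elements. *)
have atfin : finite_set (atoms S) by exact: sub_finite_set (atoms_sub SG) Gfin.
rewrite (embdim_atoms p S Sc).
have -> : (2 * p)%N = size [seq f x.1 x.2 | x : 'I_p * bool].
  by rewrite size_map -cardE card_prod card_ord card_bool mulnC.
apply: uniq_leq_size; first by rewrite map_inj_uniq ?enum_uniq.
move=> _ /mapP[[i b] _ ->]; rewrite in_fset_set //; apply: mem_set.
by have [_ /(_ b)[]] := fP i.
Qed.
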